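(* Let $n\ge 1$, let $D\subseteq\mathbb{C}$ be invariant under complex conjugation, and let $\Omega=\Omega_D\cap\mathbb{R}^{n+1}$ be an open subset of the paravector space $\mathbb{R}^{n+1}$. For each slice function $f:\Omega\to\mathbb{R}_n$ of class $\mathcal{C}^1(\Omega)$, the following formulas hold on $\Omega\setminus\mathbb{R}$: (a) $\Gamma f=(n-1)\operatorname{Im}(x)\,f'_s$. (b) $\overline\partial f-\overline\vartheta f=(1-n)f'_s$.
   Context: $\mathbb{R}_n$ is the real Clifford algebra generated by $e_1,\dots,e_n$ with $e_ie_j+e_je_i=-2\delta_{ij}$; $x\mapsto x^c$ (Clifford conjugation) is the unique linear antiinvolution with $e_i^c=-e_i$. The paravector space $\{x_0+x_1e_1+\cdots+x_ne_n\}\subset\mathbb{R}_n$ is identified with $\mathbb{R}^{n+1}$. Let $\mathbb{S}_{\mathbb{R}_n}=\{J\in\mathbb{R}_n: J+J^c=0,\ JJ^c=1\}$, $\mathbb{C}_J=\langle 1,J\rangle$ (the subalgebra generated by $J$), and let $\mathcal{Q}_{\mathbb{R}_n}=\bigcup_{J\in\mathbb{S}_{\mathbb{R}_n}}\mathbb{C}_J$ be the quadratic cone, which contains $\mathbb{R}^{n+1}$. For $x\in\mathcal{Q}_{\mathbb{R}_n}$, $\operatorname{Re}(x)=\frac{x+x^c}{2}$ and $\operatorname{Im}(x)=\frac{x-x^c}{2}$. For $D\subseteq\mathbb{C}$ conjugation-invariant, $\Omega_D=\{\alpha+J\beta: \alpha+i\beta\in D \ (\alpha,\beta\in\mathbb{R}),\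 J\in\mathbb{S}_{\mathbb{R}_n}\}$. A stem function on $D$ is a map $F=F_1+\imath F_2:D\to\mathbb{R}_n\otimes_{\mathbb{R}}\mathbb{C}$ ($F_1,F_2$ being $\mathbb{R}_n$-valued, $\imath^2=-1$) with $F(\overline z)=\overline{F(z)}$, where $\overline{a+\imath b}=a-\imath b$. It induces the (left) slice function $f=\mathcal{I}(F):\Omega_D\to\mathbb{R}_n$, $f(\alpha+J\beta)=F_1(\alpha+i\beta)+JF_2(\alpha+i\beta)$. A slice function on $\Omega=\Omega_D\cap\mathbb{R}^{n+1}$ means the restriction to $\Omega$ of a slice function on $\Omega_D$. The spherical derivative of $f$ is $f'_s(x)=\frac12\operatorname{Im}(x)^{-1}(f(x)-f(x^c))$, $x\notin\mathbb{R}$. Operators (coefficients multiply from the left; $\partial_i=\partial/\partial x_i$; $e_{ij}=e_ie_j$): $\overline\partial=\partial_0+\sum_{i=1}^n e_i\partial_i$ (Cauchy-Riemann operator); $\overline\vartheta=\partial_0+\frac{\operatorname{Im}(x)}{|\operatorname{Im}(x)|^2}\sum_{i=1}^n x_i\partial_i$ on functions on subsets of $\mathbb{R}^{n+1}\setminus\mathbb{R}$; $L_{ij}=x_i\partial_j-x_j\partial_i$ and $\Gamma=-\sum_{1\le i<j\le n}e_{ij}L_{ij}$ (spherical Dirac operator). *)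

(* Defs.v *)
From HB Require Import structures.
From mathcomp Require Import all_boot all_order all_algebra.
From mathcomp Require Import complex.
From mathcomp Require Import all_classical all_reals all_analysis.

Set Implicit Arguments.
Unset Strict Implicit.
Unset Printing Implicit Defensive.

Import Order.TTheory GRing.Theory Num.Theory.
Import numFieldNormedType.Exports.

Local Open Scope classical_set_scope.
Local Open Scope ring_scope.
Local Open Scope complex_scope.

(* The Clifford algebra R_n on its canonical basis e_A, A a subset of
   {0, .., n-1}, where e_A is the product of the e_i for i in A in increasing
   order (lemma [bladeE]); generators are numbered from 0. A record, and not an
   alias of {ffun _}, since {ffun _} already carries the pointwise product. *)
Record clifford (R : realType) (n : nat) :=
  Clifford { blade_coef :> {ffun {set 'I_n} -> R} }.

HB.instance Definition _ R n := [isNew for @blade_coef R n].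
HB.instance Definition _ R n := [Choice of clifford R n by <:].

Section blade_signs.
Variable n : nat.
Implicit Types A B C : {set 'I_n}.

Definition symdiff A B : {set 'I_n} :=
  [set i | (i \in A) (+) (i \in B)]%SET.

(* e_A e_B = (-1) ^ (blade_swaps A B) e_(symdiff A B): each pair (i, j) of A x B
   with j < i costs a transposition, each common index a factor e_i^2 = -1. *)
Definition blade_swaps A B : nat :=
  (\sum_(i in A) \sum_(j in B) (j <= i))%N.

Lemma symdiffA : associative symdiff.
Proof. by move=> A B C; apply/setP => i; rewrite !inE addbA. Qed.

Lemma symdiffC : commutative symdiff.
Proof. by move=> A B; apply/setP => i; rewrite !inE addbC. Qed.

Lemma symdiffK A : involutive (symdiff A).
Proof. by move=> B; apply/setP => i; rewrite !inE addbA addbb. Qed.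

Lemma symdiffKr A : involutive (symdiff^~ A).
Proof. by move=> B; apply/setP => i; rewrite !inE -addbA addbb addbF. Qed.

Lemma symdiff0 A : symdiff A finset.set0 = A.
Proof. by apply/setP => i; rewrite !inE addbF. Qed.

Lemma sym0diff A : symdiff finset.set0 A = A.
Proof. by rewrite symdiffC symdiff0. Qed.

Lemma symdiffv A : symdiff A A = finset.set0.
Proof. by apply/setP => i; rewrite !inE addbb. Qed.

Lemma odd_blade_swaps A B : odd (blade_swaps A B) =
  \big[addb/false]_i \big[addb/false]_j
    [&& i \in A, j \in B & (j <= i)%N].
Proof.
rewrite /blade_swaps (big_morph odd oddD (erefl _)) big_mkcond /=.
apply: eq_bigr => i _; case: (i \in A) => /=; last by rewrite big1_eq.
rewrite (big_morph odd oddD (erefl _)) big_mkcond /=.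
by apply: eq_bigr => j _; case: (j \in B) => //=; rewrite oddb.
Qed.

Lemma odd_blade_swapsDl A B C :
  odd (blade_swaps (symdiff A B) C) =
  odd (blade_swaps A C) (+) odd (blade_swaps B C).
Proof.
rewrite !odd_blade_swaps -big_split; apply: eq_bigr => i _ /=.
rewrite -big_split; apply: eq_bigr => j _ /=.
by rewrite inE; case: (i \in A); case: (i \in B) => //=; rewrite ?addbb ?addbF.
Qed.

Lemma odd_blade_swapsDr A B C :
  odd (blade_swaps A (symdiff B C)) =
  odd (blade_swaps A B) (+) odd (blade_swaps A C).
Proof.
rewrite !odd_blade_swaps -big_split; apply: eq_bigr => i _ /=.
rewrite -big_split; apply: eq_bigr => j _ /=; rewrite inE.
by case: (i \in A); case: (j \in B); case: (j \in C) => //=; rewrite ?addbb ?addbF.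
Qed.

Lemma blade_swaps0l A : blade_swaps finset.set0 A = 0%N.
Proof. by rewrite /blade_swaps big_set0. Qed.

Lemma blade_swaps0r A : blade_swaps A finset.set0 = 0%N.
Proof. by rewrite /blade_swaps big1 // => i _; rewrite big_set0. Qed.

End blade_signs.

Section clifford_algebra.
Variables (R : realType) (n : nat).
Local Notation Cl := (clifford R n).
Implicit Types (x y z : Cl) (A B C : {set 'I_n}) (a b : R).

Lemma clP x y : (forall A, x A = y A) -> x = y.
Proof.
by case: x y => [x] [y] /= xy; congr Clifford; apply/ffunP.
Qed.

Definition cl_zero : Cl := Clifford [ffun=> 0].
Definition cl_opp x : Cl := Clifford [ffun A => - x A].
Definition cl_add x y : Cl := Clifford [ffun A => x A + y A].
Definition cl_scale a x : Cl := Clifford [ffun A => a * x A].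

Lemma cl_addA : associative cl_add.
Proof. by move=> x y z; apply: clP => A; rewrite !ffunE addrA. Qed.
Lemma cl_addC : commutative cl_add.
Proof. by move=> x y; apply: clP => A; rewrite !ffunE addrC. Qed.
Lemma cl_add0 : left_id cl_zero cl_add.
Proof. by move=> x; apply: clP => A; rewrite !ffunE add0r. Qed.
Lemma cl_addN : left_inverse cl_zero cl_opp cl_add.
Proof. by move=> x; apply: clP => A; rewrite !ffunE addNr. Qed.

HB.instance Definition _ :=
  GRing.isZmodule.Build Cl cl_addA cl_addC cl_add0 cl_addN.

Lemma cl_scaleA a b x : cl_scale a (cl_scale b x) = cl_scale (a * b) x.
Proof. by apply: clP => A; rewrite !ffunE mulrA. Qed.
Lemma cl_scale1 : left_id 1 cl_scale.
Proof. by move=> x; apply: clP => A; rewrite !ffunE mul1r. Qed.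
Lemma cl_scaleDr : right_distributive cl_scale +%R.
Proof. by move=> a x y; apply: clP => A; rewrite !ffunE mulrDr. Qed.
Lemma cl_scaleDl x : {morph cl_scale^~ x : a b / a + b >-> a + b}.
Proof. by move=> a b; apply: clP => A; rewrite !ffunE mulrDl. Qed.

HB.instance Definition _ := GRing.Zmodule_isLmodule.Build R Cl
  cl_scaleA cl_scale1 cl_scaleDr cl_scaleDl.

Lemma cl0E A : (0 : Cl) A = 0.
Proof. by rewrite ffunE. Qed.
Lemma clDE x y A : (x + y) A = x A + y A.
Proof. by rewrite ffunE. Qed.
Lemma clNE x A : (- x) A = - x A.
Proof. by rewrite ffunE. Qed.
Lemma clZE a x A : (a *: x) A = a * x A.
Proof. by rewrite ffunE. Qed.
Lemma cl_sumE (I : Type) (r : seq I) (P : pred I) (F : I -> Cl) A :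
  (\sum_(i <- r | P i) F i) A = \sum_(i <- r | P i) F i A.
Proof. by apply: (big_morph (fun x : Cl => x A) (fun x y => clDE x y A) (cl0E A)). Qed.

Definition blade A : Cl := Clifford [ffun B => (B == A)%:R].

Definition cl_one : Cl := blade finset.set0.

(* Coefficient of e_C in x * y: sum over the pairs (A, B) with
   symdiff A B = C, i.e. B = symdiff A C. *)
Definition cl_mul x y : Cl := Clifford [ffun C =>
  \sum_(A : {set 'I_n}) (-1) ^+ blade_swaps A (symdiff A C)
     * (x A * y (symdiff A C))].

Lemma cl_mulA : associative cl_mul.
Proof.
move=> x y z; apply: clP => D; rewrite !ffunE.
pose G A B := (-1) ^+ (blade_swaps A (symdiff A D)
    + blade_swaps B (symdiff B (symdiff A D)))
    * (x A * (y B * z (symdiff B (symdiff A D)))).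
transitivity (\sum_A \sum_B G A B).
  apply: eq_bigr => A _; rewrite !ffunE !mulr_sumr; apply: eq_bigr => B _.
  by rewrite /G exprD -!mulrA; congr (_ * _); rewrite mulrCA.
transitivity (\sum_A \sum_C G A (symdiff A C)).
  apply: eq_bigr => A _; rewrite (reindex_inj (inv_inj (@symdiffK n A))).
  by [].
rewrite exchange_big; apply: eq_bigr => C _ /=.
rewrite !ffunE mulr_suml mulr_sumr; apply: eq_bigr => A _; rewrite /G.
have -> : symdiff (symdiff A C) (symdiff A D) = symdiff C D.
  by rewrite (symdiffC A C) -symdiffA symdiffK.
rewrite -!mulrA [RHS]mulrA -exprD; congr (_ * _).
rewrite -[LHS]signr_odd -[RHS]signr_odd; congr (_ ^+ nat_of_bool _).
rewrite !oddD !odd_blade_swapsDr !odd_blade_swapsDl.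
by repeat match goal with |- context [odd ?k] => case: (odd k) end.
Qed.

Lemma cl_mulDl : left_distributive cl_mul +%R.
Proof.
move=> x y z; apply: clP => C; rewrite !ffunE -big_split.
by apply: eq_bigr => A _ /=; rewrite ffunE mulrDl mulrDr.
Qed.

Lemma cl_mulDr : right_distributive cl_mul +%R.
Proof.
move=> x y z; apply: clP => C; rewrite !ffunE -big_split.
by apply: eq_bigr => A _ /=; rewrite ffunE !mulrDr.
Qed.

Lemma cl_mul1l : left_id cl_one cl_mul.
Proof.
move=> x; apply: clP => C; rewrite ffunE (bigD1 finset.set0) //= big1.
  by rewrite blade_swaps0l sym0diff ffunE eqxx !mul1r addr0.
by move=> A /negPf A0; rewrite ffunE A0 mul0r mulr0.
Qed.

Lemma cl_mul1r : right_id cl_one cl_mul.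
Proof.
move=> x; apply: clP => C; rewrite ffunE (bigD1 C) //= big1.
  by rewrite symdiffv blade_swaps0r ffunE eqxx mulr1 mul1r addr0.
move=> A /negPf AC; rewrite ffunE.
case: eqP => [A0|]; last by rewrite !mulr0.
by move: AC; rewrite -(symdiffK A C) A0 symdiff0 eqxx.
Qed.

Lemma cl_one_neq0 : cl_one != 0.
Proof.
apply/eqP => /(congr1 (fun x : Cl => x finset.set0)).
by rewrite cl0E ffunE eqxx => /eqP; rewrite oner_eq0.
Qed.

HB.instance Definition _ := GRing.Zmodule_isNzRing.Build Cl
  cl_mulA cl_mul1l cl_mul1r cl_mulDl cl_mulDr cl_one_neq0.

Lemma clME x y C : (x * y) C =
  \sum_(A : {set 'I_n}) (-1) ^+ blade_swaps A (symdiff A C)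
     * (x A * y (symdiff A C)).
Proof. by rewrite ffunE. Qed.

Lemma cl_scaleAl a x y : a *: (x * y) = (a *: x) * y.
Proof.
apply: clP => C; rewrite clZE !clME mulr_sumr; apply: eq_bigr => A _.
by rewrite clZE mulrCA !mulrA.
Qed.

HB.instance Definition _ := GRing.Lmodule_isLalgebra.Build R Cl cl_scaleAl.

Lemma cl_scaleAr a x y : a *: (x * y) = x * (a *: y).
Proof.
apply: clP => C; rewrite clZE !clME mulr_sumr; apply: eq_bigr => A _.
by rewrite clZE mulrCA; congr (_ * _); rewrite mulrCA.
Qed.

HB.instance Definition _ := GRing.Lalgebra_isAlgebra.Build R Cl cl_scaleAr.

Definition cl_unit : pred Cl := fun x => `[< exists y, y * x = 1 /\ x * y = 1 >].
Definition cl_inv x : Cl :=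
  if pselect (exists y, y * x = 1 /\ x * y = 1) is left e
  then projT1 (cid e) else x.

Lemma cl_mulVx : {in cl_unit, left_inverse 1 cl_inv *%R}.
Proof.
move=> x /asboolP ux; rewrite /cl_inv; case: pselect => // e.
by case: (cid e) => y [].
Qed.
Lemma cl_mulxV : {in cl_unit, right_inverse 1 cl_inv *%R}.
Proof.
move=> x /asboolP ux; rewrite /cl_inv; case: pselect => // e.
by case: (cid e) => y [].
Qed.
Lemma cl_unitP x y : y * x = 1 /\ x * y = 1 -> cl_unit x.
Proof. by move=> xy; apply/asboolP; exists y. Qed.
Lemma cl_inv_out : {in [predC cl_unit], cl_inv =1 id}.
Proof.
move=> x /negP ux; rewrite /cl_inv; case: pselect => // e.
by case: ux; apply/asboolP.
Qed.

HB.instance Definition _ := GRing.NzRing_hasMulInverse.Build Cl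
  cl_mulVx cl_mulxV cl_unitP cl_inv_out.

Definition gen (i : 'I_n) : Cl := blade [set i]%SET.

Lemma blade0 : blade finset.set0 = 1. Proof. by []. Qed.

Lemma bladeM A B :
  blade A * blade B = (-1) ^+ blade_swaps A B *: blade (symdiff A B).
Proof.
apply: clP => C; rewrite clME clZE (bigD1 A) //= big1.
  rewrite !ffunE eqxx mul1r addr0.
  case: (eqVneq C (symdiff A B)) => [->|CAB]; first by rewrite symdiffK eqxx.
  case: eqP => [ACB|]; last by rewrite !mulr0.
  by move: CAB; rewrite -ACB symdiffK eqxx.
by move=> A' /negPf A'A; rewrite ffunE A'A mul0r mulr0.
Qed.

Lemma cl_bladeE x : x = \sum_(A : {set 'I_n}) x A *: blade A.
Proof.
apply: clP => B; rewrite cl_sumE (bigD1 B) // big1.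
  by rewrite clZE ffunE eqxx mulr1 /= addr0.
by move=> A /andP[_ /negPf AB]; rewrite clZE ffunE eq_sym AB mulr0.
Qed.

Lemma bladeE A : blade A = \prod_(i <- enum A) gen i.
Proof.
suff H s : sorted ltn (map val s) ->
    \prod_(i <- s) gen i = blade [set i in s]%SET.
  rewrite H; last first.
    rewrite /enum_mem -enumT.
    apply: (subseq_sorted ltn_trans (s2 := map val (enum 'I_n))).
      by apply: map_subseq; apply: filter_subseq.
    by rewrite val_enum_ord iota_ltn_sorted.
  by congr (blade _); apply/setP => i; rewrite !inE mem_enum.
elim: s => [|i s IH] /=.
  by move=> _; rewrite big_nil -blade0; congr (blade _); apply/setP => i; rewrite !inE.
move=> ps; rewrite big_cons IH; last exact: path_sorted ps.
have lt_i j : j \in s -> (i < j)%N.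
  move=> js; have /allP := order_path_min ltn_trans ps.
  by apply; apply: map_f.
rewrite /gen bladeM /blade_swaps big_set1 big1 ?expr0 ?scale1r.
  congr (blade _); apply/setP => j; rewrite !inE.
  case: eqP => [->|//] /=; apply/negP => /lt_i.
  by rewrite ltnn.
by move=> j; rewrite inE => /lt_i; rewrite ltnNge => /negPf ->.
Qed.

Lemma gen_anticomm i j : gen i * gen j + gen j * gen i = (- 2 * (i == j)%:R)%:A.
Proof.
rewrite /gen !bladeM (symdiffC [set j]%SET) -scalerDl.
rewrite /blade_swaps !big_set1; case: (eqVneq i j) => [->|ij].
  rewrite symdiffv leqnn blade0; congr (_ *: _).
  by rewrite mulr1 expr1 -opprD.
have : (j <= i)%N (+) (i <= j)%N.
  by case: (ltngtP i j) => // /val_inj /eqP; rewrite (negPf ij).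
by case: (j <= i)%N; case: (i <= j)%N => // _;
  rewrite !(expr0, expr1) ?subrr ?addNr mulr0 !scale0r.
Qed.

(* Clifford conjugation. The anti-involution reverses products and sends e_i to
   -e_i = e_i^-1, hence e_A to e_A^-1; and e_A e_A = (-1) ^ (blade_swaps A A). *)
Definition cconj x : Cl :=
  Clifford [ffun A => (-1) ^+ blade_swaps A A * x A].

Lemma cconjE x A : cconj x A = (-1) ^+ blade_swaps A A * x A.
Proof. by rewrite ffunE. Qed.

Lemma cconj_linear : linear cconj.
Proof.
move=> a x y; apply: clP => A.
by rewrite !(cconjE, clDE, clZE) mulrDr; congr (_ + _); rewrite mulrCA.
Qed.

HB.instance Definition _ := GRing.isLinear.Build R Cl Cl *:%R cconj cconj_linear.

Lemma cconjK : involutive cconj.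
Proof. by move=> x; apply: clP => A; rewrite !cconjE signrMK. Qed.

Lemma cconjM x y : cconj (x * y) = cconj y * cconj x.
Proof.
apply: clP => C; rewrite cconjE !clME mulr_sumr.
rewrite (reindex_inj (inv_inj (@symdiffKr n C))) /=.
apply: eq_bigr => A _.
rewrite symdiffKr !cconjE (mulrC (x _)).
rewrite [in RHS]mulrACA !mulrA -!exprD; congr (_ * _ * _).
rewrite -[LHS]signr_odd -[RHS]signr_odd; congr (_ ^+ nat_of_bool _).
rewrite !oddD !odd_blade_swapsDr !odd_blade_swapsDl.
by repeat match goal with |- context [odd ?k] => case: (odd k) end.
Qed.

Lemma cconj_gen i : cconj (gen i) = - gen i.
Proof.
apply: clP => A; rewrite cconjE clNE !ffunE.
case: eqP => [->|]; last by rewrite mulr0 oppr0.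
by rewrite /blade_swaps !big_set1 leqnn expr1 mulN1r.
Qed.

Definition cim x : Cl := 2^-1 *: (x - cconj x).

(* The Euclidean norm of R_n = R^(2^n); on paravectors it is that of R^(n+1). *)
Definition enorm x : R := Num.sqrt (\sum_(A : {set 'I_n}) x A ^+ 2).

Definition imunits : set Cl := [set J | J + cconj J = 0 /\ J * cconj J = 1].

End clifford_algebra.

Section slice_functions.
Variables (R : realType) (n : nat).
Local Notation Cl := (clifford R n).

(* R^(n+1) is 'rV[R]_n.+1; its coordinate 0 is x_0, and its coordinate
   lift ord0 i is the one multiplying gen i. *)
Definition paravector (x : 'rV[R]_n.+1) : Cl :=
  (x ord0 ord0)%:A + \sum_(i < n) x ord0 (lift ord0 i) *: gen R i.

Definition pconj (x : 'rV[R]_n.+1) : 'rV[R]_n.+1 :=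
  \row_j (if j == ord0 then x ord0 j else - x ord0 j).

Lemma paravector_pconj x : paravector (pconj x) = cconj (paravector x).
Proof.
rewrite /paravector mxE eqxx linearD linearZ linear_sum /=; congr (_ + _).
  congr (_ *: _); rewrite -(@blade0 R n); apply: clP => A; rewrite cconjE !ffunE.
  by case: eqP => [->|]; rewrite ?blade_swaps0l ?mul1r ?mulr0.
by apply: eq_bigr => i _; rewrite mxE linearZ /= cconj_gen scaleNr scalerN.
Qed.

Definition conj_invariant (D : set R[i]) : Prop :=
  forall z, D z -> D (conjc z).

Definition circularization (D : set R[i]) : set Cl :=
  [set x | exists a b J, [/\ D (a +i* b), imunits J & x = a%:A + J * b%:A]].

Definition paradomain (D : set R[i]) : set 'rV[R]_n.+1 :=
  [set x | circularization D (paravector x)].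

(* R_n (x) C is Cl * Cl, the pair (a, b) standing for a + \imath b. *)
Definition tconj (w : Cl * Cl) : Cl * Cl := (w.1, - w.2).

(* Functions on a subset are total functions constrained on that subset only. *)
Definition stem_function (D : set R[i]) (F : R[i] -> Cl * Cl) : Prop :=
  forall z, D z -> F (conjc z) = tconj (F z).

Definition induced_by (D : set R[i]) (F : R[i] -> Cl * Cl) (g : Cl -> Cl) :
    Prop :=
  forall a b J, D (a +i* b) -> imunits J ->
    g (a%:A + J * b%:A) = (F (a +i* b)).1 + J * (F (a +i* b)).2.

Definition slice_function (D : set R[i]) (g : Cl -> Cl) : Prop :=
  exists2 F, stem_function D F & induced_by D F g.

Definition para_slice_function (D : set R[i]) (f : 'rV[R]_n.+1 -> Cl) : Prop :=
  exists2 g, slice_function D g &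
    forall x, paradomain D x -> f x = g (paravector x).

Implicit Types (f : 'rV[R]_n.+1 -> Cl) (x : 'rV[R]_n.+1).

Definition pderivable (j : 'I_n.+1) f x : Prop :=
  forall A, derivable (fun y => f y A) x (delta_mx ord0 j).

Definition pderiv (j : 'I_n.+1) f x : Cl :=
  Clifford [ffun A => 'D_(delta_mx ord0 j) (fun y => f y A) x].

(* Only used with U open. *)
Definition classC1 (U : set 'rV[R]_n.+1) f : Prop :=
  forall j x, U x -> pderivable j f x /\
    forall A, {for x, continuous (fun y => pderiv j f y A)}.

Definition real_points : set 'rV[R]_n.+1 :=
  [set x | exists r : R, paravector x = r%:A].

Definition spherical_derivative f x : Cl :=
  2^-1 *: ((cim (paravector x))^-1 * (f x - f (pconj x))).

Definition cauchy_riemann f x : Cl :=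
  pderiv ord0 f x + \sum_(i < n) gen R i * pderiv (lift ord0 i) f x.

Definition global_theta f x : Cl :=
  pderiv ord0 f x +
  ((enorm (cim (paravector x)) ^+ 2)^-1 *: cim (paravector x)) *
  \sum_(i < n) x ord0 (lift ord0 i) *: pderiv (lift ord0 i) f x.

Definition Lop (i j : 'I_n) f x : Cl :=
  x ord0 (lift ord0 i) *: pderiv (lift ord0 j) f x -
  x ord0 (lift ord0 j) *: pderiv (lift ord0 i) f x.

Definition spherical_dirac f x : Cl :=
  - \sum_(i < n) \sum_(j < n | (i < j)%N) (gen R i * gen R j) * Lop i j f x.

End slice_functions.

(* Main.v *)
Require Import Defs.
From HB Require Import structures.
From mathcomp Require Import all_boot all_order all_algebra.
From mathcomp Require Import complex.
From mathcomp Require Import all_classical all_reals all_analysis.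
From mathcomp Require Import ring lra.

Import Order.TTheory GRing.Theory Num.Theory.
Import numFieldNormedType.Exports.

Local Open Scope classical_set_scope.
Local Open Scope ring_scope.

(** Write Im x for the vector part of the paravector x and r(x) for |Im x|^2.
    A slice function restricted to paravectors has the form
      f(z) = H1 + Im(z) H2,
    where H1 and H2 depend on z only through x_0 and r(z), and H2 is the
    spherical derivative f'_s ([slice_on_sphere], [spherical_derivativeE]).
    With x_0 kept constant, the partial derivative of Im z in direction j >= 1
    is e_j and that of r is 2 x_j, so
      d_j f(x) = e_j f'_s(x) + x_j K,   K = 2 (H1' + Im(x) H2'),
    with the same K for all j ([pderiv_slice]).

    Both formulas are algebraic consequences of this shape.  In L_ij f the terms
    in K cancel, and e_i e_j (x_i e_j - x_j e_i) = - (x_i e_i + x_j e_j); summing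
    over pairs gives n - 1 times Im x ([spherical_diracE]).  In the difference of
    the Cauchy-Riemann and the global operator the derivative d_0 cancels, and
      sum_j e_j d_j f = - n f'_s + Im(x) K,
      Im(x) |Im(x)|^-2 sum_j x_j d_j f = - f'_s + Im(x) K
    ([cauchy_riemann_global_theta]).

    The analytic point is that the stem function is not assumed to be regular,
    so that differentiability of H1 and H2 in r has to be recovered from f.
    Fix k with x_k <> 0.  Moving x along the k-th axis crosses the spheres
    r = constant transversally, at a point y(s) of the sphere r = s which is a
    differentiable function of s ([radial_step]).  The values of f at y(s) and at
    its conjugate determine H1(s) and H2(s) ([representation_formula]), and they
    are differentiable in s because f has a k-th partial derivative at x and at
    its conjugate ([local_stem]).  Only derivatives of functions of one real
    variable occur; they are taken coefficient by coefficient in the Clifford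
    algebra. *)

Set Implicit Arguments.
Unset Strict Implicit.
Unset Printing Implicit Defensive.

(** * Vector parts of paravectors and the representation formula *)

Section vector_part.
Context {R : realType} {n : nat}.
Local Notation Cl := (clifford R n).
Implicit Types (x y : 'rV[R]_n.+1) (u v : Cl).

Definition vector_part x : Cl := \sum_(i < n) x ord0 (lift ord0 i) *: gen R i.

Definition vpart_normsq x : R := \sum_(i < n) x ord0 (lift ord0 i) ^+ 2.

Lemma gen_sqr (i : 'I_n) : gen R i * gen R i = - 1.
Proof.
have := gen_anticomm R i i; rewrite eqxx mulr1 -mulr2n => e.
apply: (@scalerI R _ 2%:R); first by rewrite pnatr_eq0.
by rewrite scaler_nat e scalerN scaleNr.
Qed.

Lemma gen_swap (i j : 'I_n) : i != j ->
  gen R j * gen R i = - (gen R i * gen R j).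
Proof.
move=> /negPf ij; have := gen_anticomm R i j.
by rewrite ij mulr0 scale0r => /eqP; rewrite addrC addr_eq0 => /eqP.
Qed.

Lemma cconj_scalar (a : R) : cconj (a%:A : Cl) = a%:A.
Proof.
rewrite linearZ /=; congr (_ *: _); apply: clP => A.
rewrite cconjE -(@blade0 R n) !ffunE.
by case: eqP => [->|]; rewrite ?blade_swaps0l ?mul1r ?mulr0.
Qed.

Lemma cconj_vector_part x : cconj (vector_part x) = - vector_part x.
Proof.
rewrite /vector_part linear_sum -sumrN; apply: eq_bigr => i _.
by rewrite linearZ /= cconj_gen scalerN.
Qed.

Lemma paravectorE x : paravector x = (x ord0 ord0)%:A + vector_part x.
Proof. by []. Qed.

Lemma half_double (V : lmodType R) (v : V) : 2^-1 *: (v + v) = v.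
Proof.
have e : 2^-1 + 2^-1 = 1 :> R by field.
by rewrite scalerDr -scalerDl e scale1r.
Qed.

Lemma cim_paravector x : cim (paravector x) = vector_part x.
Proof.
rewrite /cim paravectorE [cconj (_ + _)]linearD /= cconj_scalar.
by rewrite cconj_vector_part opprD opprK addrACA subrr add0r half_double.
Qed.

Lemma vector_part_pconj x : vector_part (pconj x) = - vector_part x.
Proof.
by rewrite /vector_part -sumrN; apply: eq_bigr => i _; rewrite mxE /= scaleNr.
Qed.

Lemma vpart_normsq_pconj x : vpart_normsq (pconj x) = vpart_normsq x.
Proof. by apply: eq_bigr => i _; rewrite mxE /= sqrrN. Qed.

(** Adding the double sum over e_i e_j to the same sum with i and j exchanged
    leaves only the diagonal, by anticommutation. *)
Lemma vector_part_sqr x : vector_part x * vector_part x = - (vpart_normsq x)%:A.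
Proof.
have dbl : vector_part x * vector_part x =
    \sum_(i < n) \sum_(j < n) (x ord0 (lift ord0 i) * x ord0 (lift ord0 j)) *:
      (gen R i * gen R j).
  rewrite /vector_part mulr_suml; apply: eq_bigr => i _.
  rewrite mulr_sumr; apply: eq_bigr => j _.
  by rewrite -scalerAl -scalerAr scalerA.
rewrite -[LHS]half_double {1}dbl exchange_big /= dbl -big_split /=.
rewrite /vpart_normsq scaler_suml -sumrN scaler_sumr; apply: eq_bigr => i _.
rewrite -big_split /= (bigD1 i) //= big1 ?addr0.
  by rewrite half_double gen_sqr scalerN expr2.
move=> j ji.
by rewrite (gen_swap ji) scalerN mulrC subrr.
Qed.

Lemma vector_part_re x : vector_part x finset.set0 = 0.
Proof.
rewrite cl_sumE big1 // => i _; rewrite clZE /gen /blade ffunE.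
case: eqP => [/setP/(_ i)|]; last by rewrite mulr0.
by rewrite !inE eqxx.
Qed.

(** The sign in the e_A coefficient of the conjugate is the one that occurs in
    e_A e_A, so the scalar coefficient of the product is a sum of squares. *)
Lemma enorm_sqr u : enorm u ^+ 2 = (u * cconj u) finset.set0.
Proof.
rewrite /enorm sqr_sqrtr; last by apply: sumr_ge0 => A _; exact: sqr_ge0.
rewrite clME; apply: eq_bigr => A _; rewrite symdiff0 cconjE mulrCA signrMK.
by rewrite expr2.
Qed.

Lemma enorm_vector_part x : enorm (vector_part x) ^+ 2 = vpart_normsq x.
Proof.
rewrite enorm_sqr cconj_vector_part mulrN vector_part_sqr opprK clZE.
by rewrite -(@blade0 R n) ffunE eqxx mulr1.
Qed.

Lemma vpart_normsq_gt0 x (i : 'I_n) :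
  x ord0 (lift ord0 i) != 0 -> 0 < vpart_normsq x.
Proof.
move=> xi; rewrite /vpart_normsq (bigD1 i) //=.
apply: ltr_pwDl; first by rewrite exprn_even_gt0.
by apply: sumr_ge0 => j _; exact: sqr_ge0.
Qed.

Lemma nonreal_coord x : ~ @real_points R n x ->
  exists i : 'I_n, x ord0 (lift ord0 i) != 0.
Proof.
move=> nr; apply: contrapT => /forallNP x0; apply: nr.
exists (x ord0 ord0); rewrite paravectorE /vector_part big1 ?addr0 // => i _.
by have /negP := x0 i; rewrite negbK => /eqP ->; rewrite scale0r.
Qed.

Lemma vector_part_inv x : vpart_normsq x != 0 ->
  (vector_part x)^-1 = - (vpart_normsq x)^-1 *: vector_part x.
Proof.
move=> x0; set u := vector_part x.
have e : u * (- (vpart_normsq x)^-1 *: u) = 1.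
  rewrite -scalerAr vector_part_sqr scaleNr scalerN opprK.
  by rewrite scalerA mulVf ?scale1r.
have e' : (- (vpart_normsq x)^-1 *: u) * u = 1.
  rewrite -scalerAl vector_part_sqr scaleNr scalerN opprK.
  by rewrite scalerA mulVf ?scale1r.
have uu : u \is a GRing.unit
  by apply/unitrP; exists (- (vpart_normsq x)^-1 *: u).
by apply: (mulrI uu); rewrite e divrr.
Qed.

(** If x = a + J b, then every y with the same real part and the same |Im y| is
    a + K b with K = Im(y) / b an imaginary unit (b may be negative); so the
    stem function is evaluated at the single point a + i b on the whole sphere. *)
Lemma slice_on_sphere (D : set R[i]) (f : 'rV[R]_n.+1 -> Cl) x :
  para_slice_function D f -> paradomain D x -> vpart_normsq x != 0 ->
  exists C1 C2 : Cl, forall y, y ord0 ord0 = x ord0 ord0 ->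
    vpart_normsq y = vpart_normsq x ->
    paradomain D y /\ f y = C1 + vector_part y * C2.
Proof.
move=> [g [F _ gF] fg] [a [b [J [Dab [JJ JJ1] xab]]]] x0.
have cJ : cconj J = - J by apply/eqP; rewrite -addr_eq0 addrC JJ.
have imx : vector_part x = b *: J.
  rewrite -cim_paravector xab /cim [cconj (_ + _)]linearD /= cconj_scalar.
  rewrite -scalerAr mulr1.
  by rewrite linearZ /= cJ scalerN opprD opprK addrACA subrr add0r half_double.
have rex : x ord0 ord0 = a.
  have /(congr1 (fun u : Cl => u finset.set0)) : (x ord0 ord0)%:A = a%:A :> Cl.
    apply: (addIr (vector_part x)); rewrite -paravectorE xab imx.
    by rewrite -scalerAr mulr1.
  by rewrite !clZE -(@blade0 R n) ffunE eqxx !mulr1.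
have b2 : vpart_normsq x = b ^+ 2.
  have := vector_part_sqr x; rewrite imx -scalerAl -scalerAr scalerA.
  have -> : J * J = - 1 by apply/eqP; rewrite -eqr_oppLR -mulrN -cJ JJ1.
  rewrite scalerN => /oppr_inj /(congr1 (fun u : Cl => u finset.set0)).
  by rewrite !clZE -(@blade0 R n) ffunE eqxx !mulr1 expr2.
have b0 : b != 0 by move: x0; rewrite b2 sqrf_eq0.
exists (F (a +i* b)%C).1, (b^-1 *: (F (a +i* b)%C).2) => y rey yx.
pose K := b^-1 *: vector_part y.
have KU : imunits K.
  have cK : cconj K = - K.
    by rewrite /K linearZ /= cconj_vector_part scalerN.
  split; first by rewrite cK subrr.
  rewrite cK mulrN /K -scalerAl -scalerAr vector_part_sqr yx b2 !scalerN opprK.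
  by rewrite !scalerA -[RHS]scale1r; congr (_ *: _); field.
have yK : paravector y = a%:A + K * b%:A.
  by rewrite paravectorE rey rex /K -scalerAr mulr1 scalerA divff ?scale1r.
have Dy : paradomain D y by exists a, b, K.
split=> //; rewrite fg // yK gF // /K.
by rewrite -scalerAl -scalerAr.
Qed.

Lemma spherical_derivativeE f x C1 C2 : vpart_normsq x != 0 ->
  f x = C1 + vector_part x * C2 ->
  f (pconj x) = C1 + vector_part (pconj x) * C2 ->
  spherical_derivative f x = C2.
Proof.
move=> x0 fx fxc; rewrite /spherical_derivative cim_paravector fx fxc.
rewrite vector_part_pconj mulNr opprD opprK addrACA subrr add0r.
rewrite mulrDr half_double vector_part_inv // -scalerAl mulrA vector_part_sqr.
by rewrite scaleNr mulNr scalerN opprK -scalerAl scalerA mulVf // scale1r mul1r.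
Qed.

(** The two values of the stem function on a sphere are determined by the values
    of f at one point y of the sphere and at its conjugate. *)
Lemma representation_formula (D : set R[i]) (f : 'rV[R]_n.+1 -> Cl) y z :
  para_slice_function D f -> paradomain D z -> vpart_normsq z != 0 ->
  y ord0 ord0 = z ord0 ord0 -> vpart_normsq y = vpart_normsq z ->
  f z = 2^-1 *: (f y + f (pconj y)) + vector_part z * spherical_derivative f y.
Proof.
move=> sf Dz z0 re nm.
have [C1 [C2 C]] := slice_on_sphere sf Dz z0.
have y0 : vpart_normsq y != 0 by rewrite nm.
have [_ fz] := C z erefl erefl.
have [_ fy] := C y re nm.
have [_ fyc] : paradomain D (pconj y) /\
    f (pconj y) = C1 + vector_part (pconj y) * C2.
  by apply: C; rewrite ?vpart_normsq_pconj // mxE.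
rewrite (spherical_derivativeE y0 fy fyc) fz fy fyc vector_part_pconj mulNr.
by rewrite addrACA subrr addr0 half_double.
Qed.

End vector_part.

(** * First-order operators on a function with partials e_j G + x_j K *)

(** Each index i lies in exactly n - 1 of the pairs j < k; this is where the
    factor n - 1 in the formula for the spherical Dirac operator comes from. *)
Lemma sum_pairs (R : realType) (n : nat) (V : lmodType R) (F : 'I_n -> V) :
  \sum_(i < n) \sum_(j < n | (i < j)%N) (F i + F j) =
  (n%:R - 1 : R) *: \sum_(i < n) F i.
Proof.
under eq_bigr do rewrite big_split /=.
rewrite big_split /=.
rewrite [X in _ + X](exchange_big_dep xpredT) //= -big_split scaler_sumr /=.
apply: eq_bigr => i _.
rewrite !sumr_const -mulrnDr -scaler_nat; congr (_ *: _).
rewrite -!sum1_card.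
have -> : (n%:R - 1 : R) = (\sum_(j < n | j != i) 1)%N%:R.
  rewrite sum1_card cardC1 card_ord.
  by rewrite -subn1 natrB // (leq_ltn_trans (leq0n i)).
congr (_ *+ _); rewrite [RHS](bigID (fun j : 'I_n => (i < j)%N)) /=.
congr (_ + _)%N.
  by apply: eq_bigl => j; rewrite -[LHS]/(i < j)%N -val_eqE; case: (ltngtP i j).
by apply: eq_bigl => j; rewrite -[LHS]/(j < i)%N -val_eqE; case: (ltngtP i j).
Qed.

Section operators.
Context {R : realType} {n : nat}.
Local Notation Cl := (clifford R n).
Variables (f : 'rV[R]_n.+1 -> Cl) (x : 'rV[R]_n.+1) (G K : Cl).
(* For a slice function G will be the spherical derivative at x. *)
Hypothesis df : forall j : 'I_n,
  pderiv (lift ord0 j) f x = gen R j * G + x ord0 (lift ord0 j) *: K.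

Lemma LopE (i j : 'I_n) : Lop i j f x =
  (x ord0 (lift ord0 i) *: gen R j - x ord0 (lift ord0 j) *: gen R i) * G.
Proof.
rewrite /Lop !df !scalerDr !scalerA opprD addrACA.
by rewrite [x _ (lift ord0 j) * _]mulrC subrr addr0 mulrBl !scalerAl.
Qed.

Lemma spherical_diracE :
  spherical_dirac f x = (n%:R - 1 : R) *: (vector_part x * G).
Proof.
rewrite /spherical_dirac /vector_part mulr_suml -sum_pairs -sumrN.
apply: eq_bigr => i _; rewrite -sumrN; apply: eq_bigr => j ij.
have ne : i != j by rewrite -val_eqE ltn_eqF.
(* e_i e_j (x_i e_j - x_j e_i) = - (x_i e_i + x_j e_j) *)
rewrite LopE mulrA -mulNr -mulrDl; congr (_ * _).
rewrite mulrBr -!scalerAr -mulrA gen_sqr mulrN1.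
rewrite -mulrA (gen_swap ne) mulrN mulrA gen_sqr mulN1r opprK.
by rewrite scalerN -opprD opprK.
Qed.

Lemma cauchy_riemann_global_theta : vpart_normsq x != 0 ->
  cauchy_riemann f x - global_theta f x = (1 - n%:R : R) *: G.
Proof.
move=> x0; rewrite /cauchy_riemann /global_theta cim_paravector.
rewrite enorm_vector_part.
rewrite opprD addrACA subrr add0r.
have -> : \sum_(i < n) gen R i * pderiv (lift ord0 i) f x =
    - (n%:R *: G) + vector_part x * K.
  under eq_bigr do rewrite df mulrDr mulrA gen_sqr mulN1r.
  rewrite big_split /= sumr_const card_ord mulNrn scaler_nat; congr (_ + _).
  rewrite /vector_part mulr_suml; apply: eq_bigr => i _.
  by rewrite -scalerAl -scalerAr.
have -> : \sum_(i < n) x ord0 (lift ord0 i) *: pderiv (lift ord0 i) f x =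
    vector_part x * G + vpart_normsq x *: K.
  under eq_bigr do rewrite df scalerDr scalerAl scalerA -expr2.
  by rewrite big_split /= -mulr_suml -scaler_suml.
rewrite mulrDr -!scalerAl mulrA vector_part_sqr mulNr -scalerAl mul1r.
rewrite scalerN scalerA mulVf // scale1r -scalerAr scalerA mulVf // scale1r.
by rewrite opprD opprK addrCA -addrA [_ - _ * K]subrr addr0 scalerBl scale1r.
Qed.

End operators.

(** * Derivatives of curves in the Clifford algebra *)

Section curves.
Context {R : realType} {n : nat}.
Local Notation Cl := (clifford R n).
Implicit Types (phi psi : R -> Cl) (t : R) (u v w : Cl).

(** Coefficientwise, to agree with the definition of the partial derivatives. *)
Definition curve_derive phi t v :=
  forall A, is_derive t (1 : R) (fun s => phi s A) (v A).

Lemma is_derive_seq_sum (I : Type) (r : seq I) (h : I -> R -> R) (dh : I -> R)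
    (t : R) : (forall i, is_derive t (1 : R) (h i) (dh i)) ->
  is_derive t (1 : R) (fun s => \sum_(i <- r) h i s) (\sum_(i <- r) dh i).
Proof.
move=> dhE; elim: r => [|i r IH].
  rewrite big_nil; under [X in is_derive _ _ X]eq_fun do rewrite big_nil.
  exact: is_derive_cst.
rewrite big_cons; under [X in is_derive _ _ X]eq_fun do rewrite big_cons.
exact: (@is_deriveD _ _ _ (h i)).
Qed.

Lemma curve_deriveD phi psi t v w : curve_derive phi t v ->
  curve_derive psi t w -> curve_derive (fun s => phi s + psi s) t (v + w).
Proof.
move=> dphi dpsi A; rewrite clDE.
under [X in is_derive _ _ X]eq_fun do rewrite clDE.
exact: (@is_deriveD _ _ _ (fun s => phi s A)).
Qed.

Lemma curve_deriveZ (a : R -> R) (da : R) phi t v : is_derive t (1 : R) a da ->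
  curve_derive phi t v ->
  curve_derive (fun s => a s *: phi s) t (a t *: v + da *: phi t).
Proof.
move=> ada dphi A; rewrite clDE !clZE.
under [X in is_derive _ _ X]eq_fun do rewrite clZE.
have := is_deriveM ada (dphi A); rewrite /GRing.scale /= [phi t A * da]mulrC.
exact.
Qed.

Lemma curve_derive_mull u phi t v : curve_derive phi t v ->
  curve_derive (fun s => u * phi s) t (u * v).
Proof.
move=> dphi C; rewrite clME.
under [X in is_derive _ _ X]eq_fun do rewrite clME.
apply: is_derive_seq_sum => A; rewrite mulrA.
under [X in is_derive _ _ X]eq_fun do rewrite mulrA.
exact: (@is_deriveZ _ _ _ (fun s => phi s _)).
Qed.

Lemma curve_derive_comp phi (a : R -> R) (da : R) t v :
  is_derive t (1 : R) a da -> curve_derive phi (a t) v ->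
  curve_derive (fun s => phi (a s)) t (da *: v).
Proof.
move=> ada dphi A; rewrite clZE mulrC.
exact: (@is_derive1_comp _ (fun s => phi s A)).
Qed.

Lemma curve_derive_scale (a : R) phi t v : curve_derive phi t v ->
  curve_derive (fun s => a *: phi s) t (a *: v).
Proof.
move=> dphi; have := curve_deriveZ (is_derive_cst a t 1) dphi.
by rewrite scale0r addr0.
Qed.

Lemma curve_derive_near phi psi t v : (\near t, phi t = psi t) ->
  curve_derive phi t v -> curve_derive psi t v.
Proof.
move=> pp dphi A; apply: near_eq_is_derive (dphi A).
by apply: filterS pp => s ->.
Qed.

(** Difference quotients of f in direction v at x are those of its restriction
    to the line through x; hence partial derivatives are derivatives of curves. *)
Lemma growth_along_line (f : 'rV[R]_n.+1 -> R) (x v : 'rV[R]_n.+1) :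
  (fun h : R => h^-1 *:
     (((fun t : R => f (t *: v + x)) \o shift 0) (h *: (1 : R)) - f (0 *: v + x))) =
  (fun h : R => h^-1 *: ((f \o shift x) (h *: v) - f x)).
Proof.
apply/funext => h; rewrite /= scale0r add0r addr0.
by congr (_ *: (f (_ *: _ + _) - _)); rewrite /GRing.scale /= mulr1.
Qed.

Lemma pderiv_line (f : 'rV[R]_n.+1 -> Cl) x j v :
  curve_derive (fun t => f (t *: delta_mx ord0 j + x)) 0 v -> pderiv j f x = v.
Proof.
move=> df; apply: clP => A; rewrite ffunE.
have [_ <-] := df A.
by rewrite /derive (growth_along_line (fun y => f y A)).
Qed.

Lemma line_pderiv (f : 'rV[R]_n.+1 -> Cl) x j : pderivable j f x ->
  curve_derive (fun t => f (t *: delta_mx ord0 j + x)) 0 (pderiv j f x).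
Proof.
move=> df A; split.
  rewrite /derivable (growth_along_line (fun y => f y A)); exact: df.
by rewrite ffunE /derive (growth_along_line (fun y => f y A)).
Qed.

End curves.

(** * Partial derivatives of slice functions *)

Section slice_pderiv.
Context {R : realType} {n : nat}.
Local Notation Cl := (clifford R n).
Implicit Types (x : 'rV[R]_n.+1).

Local Notation "x '+_[' j ']' t" :=
  (t *: delta_mx ord0 (lift ord0 j) + x) (at level 50).

Lemma line_re x (j : 'I_n) (t : R) : (x +_[j] t) ord0 ord0 = x ord0 ord0.
Proof. by rewrite !mxE mulr0 add0r. Qed.

Lemma line_coord x (i j : 'I_n) (t : R) :
  (x +_[j] t) ord0 (lift ord0 i) = x ord0 (lift ord0 i) + t * (i == j)%:R.
Proof. by rewrite !mxE eqxx /= (inj_eq lift_inj) addrC. Qed.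

Lemma line_vector_part x (j : 'I_n) (t : R) :
  vector_part (x +_[j] t) = t *: gen R j + vector_part x.
Proof.
rewrite /vector_part; under eq_bigr do rewrite line_coord scalerDl.
rewrite big_split /= addrC; congr (_ + _).
rewrite (bigD1 j) //= eqxx mulr1 big1 ?addr0 // => i /negPf ->.
by rewrite mulr0 scale0r.
Qed.

Lemma line_vpart_normsq x (j : 'I_n) (t : R) :
  vpart_normsq (x +_[j] t) =
    vpart_normsq x + (x ord0 (lift ord0 j) * t *+ 2 + t ^+ 2).
Proof.
rewrite /vpart_normsq; under eq_bigr do rewrite line_coord sqrrD -addrA.
rewrite big_split /=; congr (_ + _).
rewrite (bigD1 j) //= eqxx mulr1 big1 ?addr0 // => i /negPf ->.
by rewrite !mulr0 mul0rn expr0n addr0.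
Qed.

Lemma line_pconj x (j : 'I_n) (t : R) : pconj (x +_[j] t) = pconj x +_[j] (- t).
Proof.
apply/rowP => i; rewrite !mxE eqxx /=; case: (unliftP ord0 i) => [k|] -> /=.
  by rewrite opprD mulNr.
by rewrite !mulr0 !add0r.
Qed.

Lemma line_continuous x (j : 'I_n) :
  {for 0, continuous (fun t : R => x +_[j] t)}.
Proof.
apply: cvgD; last exact: cvg_cst.
by apply: cvgZr_tmp.
Qed.

Lemma is_derive_line_vpart_normsq x (j : 'I_n) :
  is_derive (0 : R) (1 : R) (fun t => vpart_normsq (x +_[j] t))
    (2 * x ord0 (lift ord0 j)).
Proof.
set p := x _ _.
have -> : (fun t => vpart_normsq (x +_[j] t)) =
    cst (vpart_normsq x) + (2 * p) \*: id + id ^+ 2.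
  apply/funext => t; rewrite line_vpart_normsq -/p.
  rewrite -[RHS]/(vpart_normsq x + (2 * p) * t + t ^+ 2).
  by ring.
apply: is_derive_eq.
by rewrite add0r expr1 mulr0 scale0r addr0 /GRing.scale /= mulr1.
Qed.

(** The displacement t along a coordinate axis for which the coordinate p + t
    keeps the sign of p and the squared norm of the vector part goes from N to
    s, that is (p + t)^2 = p^2 + s - N. *)
Definition radial_step (p N s : R) : R :=
  Num.sg p * Num.sqrt (s - N + p ^+ 2) - p.

Lemma radial_stepN (p N : R) : radial_step p N N = 0.
Proof.
by rewrite /radial_step subrr add0r sqrtr_sqr -numEsg subrr.
Qed.

Lemma radial_step_vpart_normsq x (j : 'I_n) (s : R) :
  let p := x ord0 (lift ord0 j) in
  p != 0 -> 0 <= s - vpart_normsq x + p ^+ 2 ->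
  vpart_normsq (x +_[j] (radial_step p (vpart_normsq x) s)) = s.
Proof.
move=> p p0 s0; rewrite line_vpart_normsq -/p; set t := radial_step _ _ _.
have : (t + p) ^+ 2 = s - vpart_normsq x + p ^+ 2.
  by rewrite /t /radial_step subrK exprMn sqr_sg p0 mul1r sqr_sqrtr.
move=> e; rewrite -[RHS](subrK (vpart_normsq x)).
by rewrite -[s - _](addrK (p ^+ 2)) -e; ring.
Qed.

Lemma is_derive_radial_step (p N : R) : p != 0 ->
  exists d, is_derive N (1 : R) (radial_step p N) d.
Proof.
move=> p0; have p2 : 0 < p ^+ 2 by rewrite exprn_even_gt0.
pose a : R -> R := fun s => s - N + p ^+ 2.
have da : is_derive N (1 : R) a 1.
  have -> : a = id + cst (- N + p ^+ 2).
    by apply/funext => s; rewrite /a -addrA.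
  by apply: is_derive_eq; rewrite addr0.
have dsq : is_derive (a N) (1 : R) Num.sqrt (2 * Num.sqrt (a N))^-1.
  by apply: is_derive1_sqrt; rewrite /a subrr add0r.
have dc := is_derive1_comp dsq da.
eexists.
have -> : radial_step p N = Num.sg p \*: (Num.sqrt \o a) + cst (- p) by [].
exact: is_deriveD.
Qed.

(** With the real part of x fixed, H1 and H2 are differentiable at r(x) although
    no regularity of the stem function is assumed: they are read off along the
    k-th axis, which is transversal to the spheres since x_k <> 0. *)
Lemma local_stem (D : set R[i]) (f : 'rV[R]_n.+1 -> Cl) x :
  para_slice_function D f -> classC1 (paradomain D) f ->
  paradomain D x -> ~ @real_points R n x ->
  exists (H1 H2 : R -> Cl) (v1 v2 : Cl),
  [/\ curve_derive H1 (vpart_normsq x) v1, curve_derive H2 (vpart_normsq x) v2,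
      H2 (vpart_normsq x) = spherical_derivative f x &
      \forall s \near vpart_normsq x, forall z, paradomain D z ->
        z ord0 ord0 = x ord0 ord0 -> vpart_normsq z = s ->
        f z = H1 s + vector_part z * H2 s].
Proof.
move=> sf C1 Dx /nonreal_coord [k]; set p := x _ _ => p0.
have N0 := vpart_normsq_gt0 p0; set N := vpart_normsq x in N0 *.
have Dxc : paradomain D (pconj x).
  have [? [? C]] := slice_on_sphere sf Dx (lt0r_neq0 N0).
  by case: (C (pconj x)); rewrite ?vpart_normsq_pconj // mxE.
have [d dtau] := is_derive_radial_step N p0.
set tau := radial_step p N in dtau.
have tauN : tau N = 0 by exact: radial_stepN.
pose y s := x +_[k] tau s.
have yN : y N = x by rewrite /y tauN scale0r add0r.
have dy : curve_derive (fun s => f (y s)) N (d *: pderiv (lift ord0 k) f x).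
  apply: (curve_derive_comp (phi := fun t => f (x +_[k] t)) dtau); rewrite tauN.
  by apply: line_pderiv; have [] := C1 (lift ord0 k) x Dx.
have dyc : curve_derive (fun s => f (pconj (y s))) N
    ((- d) *: pderiv (lift ord0 k) f (pconj x)).
  have -> : (fun s => f (pconj (y s))) = (fun s => f (pconj x +_[k] - tau s)).
    by apply/funext => s; rewrite /y line_pconj.
  apply: (curve_derive_comp (phi := fun t => f (pconj x +_[k] t))
    (is_deriveN dtau)).
  rewrite -[(- tau) N]/(- tau N) tauN oppr0.
  by apply: line_pderiv; have [] := C1 (lift ord0 k) _ Dxc.
have ysE : \forall s \near N, vpart_normsq (y s) = s.
  have : \forall s \near N, N - p ^+ 2 < s.
    by apply: lt_nbhsr; rewrite ltrBlDr ltrDl exprn_even_gt0.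
  apply: filterS => s Ns; apply: radial_step_vpart_normsq => //.
  by rewrite -/N -/p; lra.
have s0 : \forall s \near N, 0 < s by exact: lt_nbhsr.
(* Near N one has Im(y s)^-1 = - s^-1 Im(y s), with Im(y s) = tau(s) e_k + Im x,
   so that the product rule applies. *)
have [v2 dH2] : exists v2,
    curve_derive (fun s => spherical_derivative f (y s)) N v2.
  have dinv : is_derive N (1 : R) (fun s : R => - s^-1) (- (- N ^- 2 *: 1)).
    by apply: is_deriveN; apply: is_deriveV; rewrite ?lt0r_neq0.
  have dg := curve_deriveD dy (curve_derive_scale (-1) dyc).
  have := curve_derive_scale 2^-1 (curve_deriveZ dinv
    (curve_deriveD (curve_deriveZ dtau (curve_derive_mull (gen R k) dg))
                   (curve_derive_mull (vector_part x) dg))).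
  set v := (X in curve_derive _ _ X) => dv; exists v.
  apply: curve_derive_near dv; near=> s.
  have yss : vpart_normsq (y s) = s by near: s.
  have sp : 0 < s by near: s.
  rewrite /spherical_derivative cim_paravector.
  rewrite vector_part_inv yss ?lt0r_neq0 //.
  rewrite line_vector_part scaleN1r; congr (_ *: _).
  by rewrite -[in RHS]scalerAl mulrDl -scalerAl.
exists (fun s => 2^-1 *: (f (y s) + f (pconj (y s)))).
exists (fun s => spherical_derivative f (y s)).
eexists; exists v2; split.
- exact: curve_derive_scale (curve_deriveD dy dyc).
- exact: dH2.
- by rewrite yN.
near=> s => z Dz zx zs.
have yss : vpart_normsq (y s) = s by near: s.
have sp : 0 < s by near: s.
apply: (representation_formula sf Dz).
- by rewrite zs lt0r_neq0.
- by rewrite line_re.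
- by rewrite yss.
Unshelve. all: by end_near. Qed.

(** Along x + t e_j the function is H1(rho t) + (t e_j + Im x) H2(rho t) with
    rho t = r(x + t e_j) and rho'(0) = 2 x_j. The factor e_j H2 comes from the
    vector part; all the rest is proportional to x_j. *)
Lemma pderiv_slice (D : set R[i]) (f : 'rV[R]_n.+1 -> Cl) x :
  open (@paradomain R n D) -> para_slice_function D f ->
  classC1 (paradomain D) f ->
  paradomain D x -> ~ @real_points R n x ->
  exists K : Cl, forall j : 'I_n, pderiv (lift ord0 j) f x =
    gen R j * spherical_derivative f x + x ord0 (lift ord0 j) *: K.
Proof.
move=> oD sf C1 Dx nr.
have [H1 [H2 [v1 [v2 [dH1 dH2 H2N fE]]]]] := local_stem sf C1 Dx nr.
exists (2 *: (v1 + vector_part x * v2)) => j; set p := x _ _.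
have dn := is_derive_line_vpart_normsq x j.
pose rho t := vpart_normsq (x +_[j] t).
have rho0 : rho 0 = vpart_normsq x by rewrite /rho scale0r add0r.
apply: pderiv_line.
rewrite -rho0 in dH1 dH2.
have d1 := curve_derive_comp dn dH1.
have d2 := curve_derive_comp dn dH2.
have := curve_deriveD d1 (curve_deriveD
  (curve_deriveZ (is_derive_id (0 : R) (1 : R))
    (curve_derive_mull (gen R j) d2))
  (curve_derive_mull (vector_part x) d2)).
rewrite -/(rho 0) rho0 H2N scale0r add0r scale1r.
rewrite -[vector_part x * (_ *: v2)]scalerAr addrCA -scalerDr.
rewrite -/p [2 * p]mulrC -scalerA; apply: curve_derive_near.
have cx := @line_continuous x j.
have crho : {for 0, continuous rho}.
  apply: differentiable_continuous; apply/derivable1_diffP.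
  exact: (@ex_derive _ _ _ _ _ _ _ dn).
have nD : \forall t \near 0, paradomain D (x +_[j] t).
  apply: cx; apply: open_nbhs_nbhs; split=> //.
  by rewrite scale0r add0r.
have nE : \forall t \near 0, forall z, paradomain D z ->
        z ord0 ord0 = x ord0 ord0 -> vpart_normsq z = rho t ->
        f z = H1 (rho t) + vector_part z * H2 (rho t).
  by rewrite -rho0 in fE; exact: crho fE.
near=> t.
have -> : f (x +_[j] t) = H1 (rho t) + vector_part (x +_[j] t) * H2 (rho t).
  have E : forall z, paradomain D z ->
        z ord0 ord0 = x ord0 ord0 -> vpart_normsq z = rho t ->
        f z = H1 (rho t) + vector_part z * H2 (rho t) by near: t.
  by apply: E => //; [near: t | rewrite line_re].
by rewrite line_vector_part mulrDl -scalerAl.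
Unshelve. all: by end_near. Qed.

End slice_pderiv.

Theorem proposition3p2 (R : realType) (n : nat) (D : set R[i])
    (f : 'rV[R]_n.+1 -> clifford R n) :
  (1 <= n)%N ->
  conj_invariant D ->
  open (@paradomain R n D) ->
  para_slice_function D f ->
  classC1 (@paradomain R n D) f ->
  forall x : 'rV[R]_n.+1, (@paradomain R n D `\` @real_points R n) x ->
    spherical_dirac f x =
      (n%:R - 1 : R) *: (cim (paravector x) * spherical_derivative f x) /\
    cauchy_riemann f x - global_theta f x =
      (1 - n%:R : R) *: spherical_derivative f x.
Proof.
move=> _ _ oD sf C1 x [Dx nr].
have [K dfx] := pderiv_slice oD sf C1 Dx nr.
have [i xi] := nonreal_coord nr.
split; first by rewrite (spherical_diracE dfx) cim_paravector.
rewrite (cauchy_riemann_global_theta dfx) //.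
by rewrite lt0r_neq0 // (vpart_normsq_gt0 xi).
Qed.
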